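(* Let $X$ be a real normed space, and let $f,g:X\to\mathbb{R}\cup\{+\infty\}$ be two functions with a common domain $D:=f^{-1}(\mathbb{R})=g^{-1}(\mathbb{R})$, where $D$ is nonempty and convex. Denote by $f_D$ and $g_D$ the restrictions of $f$ and $g$ to $D$. Let $K\geq 0$. Then the following statements are equivalent: (i) $f$ and $g$ are convex, lower semicontinuous on $D$, and $f_D-g_D$ is Lipschitz with constant $K$. (ii) For each $x\in D$, $$\emptyset\neq\partial_{\varepsilon}f(x)\subset\partial_{\varepsilon}g(x)+B_{*}(\theta,K)\quad\text{for all }\varepsilon>0.$$ (iii) For each $x\in D$ there exists $\delta>0$ such that $$\emptyset\neq\partial_{\varepsilon}f(x)\subset\partial_{\varepsilon}g(x)+B_{*}(\theta,K)\quad\text{for all }\varepsilon\in(0,\delta).$$ (iv) For each $x\in D$, $$\partial_{\varepsilon}f(x)\cap\left[\partial_{\varepsilon}g(x)+B_{*}(\theta,K)\right]\neq\emptyset\quad\text{for all }\varepsilon>0.$$ (v) For each $x\in D$ there exists $\delta>0$ such that $$\partial_{\varepsilon}f(x)\cap\left[\partial_{\varepsilon}g(x)+B_{*}(\theta,K)\right]\neq\emptyset\quad\text{for all }\varepsilon\in(0,\delta).$$ (vi) For each $x\in D$, $$d\left(\partial_{\varepsilon}f(x),\partial_{\varepsilon}g(x)\right)\leq K\quad\text{for all }\varepsilon>0.$$ (vii) For each $x\in D$ there exists $\delta>0$ such that $$d\left(\partial_{\varepsilon}f(x),\partial_{\varepsilon}g(x)\right)\leq K\quad\text{for all }\vareps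ilon\in(0,\delta).$$
   Context: $X$ has norm $\|\cdot\|$, $X^{*}$ is its topological dual with dual norm $\|\cdot\|_{*}$, $\langle\cdot,\cdot\rangle:X\times X^{*}\to\mathbb{R}$ is the duality product, and $\theta$ denotes the zero vector. For a function $\varphi:X\to\mathbb{R}\cup\{+\infty\}$, a point $x\in X$ with $\varphi(x)<+\infty$, and $\varepsilon>0$, the $\varepsilon$-subdifferential is $$\partial_{\varepsilon}\varphi(x):=\{x^{*}\in X^{*}:\ \varphi(y)-\varphi(x)\geq\langle y-x,x^{*}\rangle-\varepsilon\ \text{ for all }y\in X\}.$$ $B_{*}(\theta,K)$ is the closed ball in $(X^{*},\|\cdot\|_{*})$ with center $\theta$ and radius $K\ge 0$. Sums of subsets of $X^{*}$ are Minkowski sums. For $A,B\subset X^{*}$, $d(A,B):=\inf\{\|a-b\|_{*}:a\in A,\ b\in B\}$, with the convention $d(A,B):=+\infty$ if $A$ or $B$ is empty. ''Lower semicontinuous on $D$'' means lower semicontinuous at every point of $D$. *)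

(* Defs.v *)
From HB Require Import structures.
From mathcomp Require Import all_boot all_order all_algebra.
From mathcomp Require Import all_classical all_reals all_analysis.
Set Implicit Arguments.
Unset Strict Implicit.
Unset Printing Implicit Defensive.
Import Order.TTheory GRing.Theory Num.Theory.
Import numFieldNormedType.Exports.
Local Open Scope classical_set_scope.
Local Open Scope ring_scope.

Section dual.
Context {R : realType} (X : normedModType R).

Definition continuous_linear : {pred X -> R^o} :=
  mem [set u : X -> R^o | linear u /\ continuous u].

Fact continuous_linear_key : pred_key continuous_linear. Proof. exact. Qed.
Canonical continuous_linear_keyed := KeyedPred continuous_linear_key.

Lemma continuous_linear_submod_closed : submod_closed continuous_linear.
Proof.
split; first by rewrite inE; split=> [a x y|]; [
  by rewrite /= scaler0 addr0 | exact: cst_continuous].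
move=> a u v /[!inE] -[lu cu] [lv cv]; split=> [b x y|x].
  have -> z : (a *: u + v) z = a *: u z + v z by [].
  by rewrite lu lv !scalerDr !scalerA (mulrC a b) addrACA.
by apply: continuousD; [exact/continuousZl_tmp/cu | exact: cv].
Qed.

HB.instance Definition _ := GRing.isSubmodClosed.Build R (X -> R^o)
  continuous_linear continuous_linear_submod_closed.

Record dual := Dual {
  dual_val :> X -> R^o ;
  _ : dual_val \in continuous_linear }.

HB.instance Definition _ := [isSub for dual_val].
HB.instance Definition _ := [Choice of dual by <:].
HB.instance Definition _ := [SubChoice_isSubLmodule of dual by <:].

Lemma dual_linear (u : dual) : linear u.
Proof. by case: u => u /= /[!inE] -[]. Qed.

Lemma dual_continuous (u : dual) : continuous u.
Proof. by case: u => u /= /[!inE] -[]. Qed.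

HB.instance Definition _ (u : dual) :=
  GRing.isLinear.Build R X R^o *:%R u (dual_linear u).

Definition dual_norm (u : dual) : R :=
  sup [set `|u x| | x in [set x : X | `|x| <= 1]].

(* The real-valued [sup] above is never the default value 0 of an unbounded or
   empty set. *)
Lemma has_sup_dual_norm (u : dual) :
  has_sup [set `|u x| | x in [set x : X | `|x| <= 1]].
Proof.
split; first by exists `|u 0|, 0 => //=; rewrite normr0.
have /linear_boundedP/pinfty_ex_gt0[M M0 uM] :=
  continuous_linear_bounded 0 (@dual_continuous u 0).
exists M => _ [x /= x1 <-].
by rewrite (le_trans (uM x))// ler_piMr// ltW.
Qed.

Definition minkowski_sum (A B : set dual) : set dual :=
  [set a + b | a in A & b in B].

(* [ereal_inf set0 = +oo]: the distance to or from the empty set is [+oo]. *)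
Definition dual_dist (A B : set dual) : \bar R :=
  ereal_inf [set (dual_norm (a - b))%:E | a in A & b in B].

(* Unlike the library's [closed_ball] (the closure of an open ball, hence empty
   for radius 0), this is [{0}] for K = 0. *)
Definition dual_ball (K : R) : set dual := closed_ball_ dual_norm 0 K.

End dual.

Section extended_real_functions.
Context {R : realType} {X : normedModType R}.
Implicit Types phi : X -> \bar R.

Definition effective_domain phi : set X := [set x | phi x \is a fin_num].

(* The products with [t = 0] or [t = 1] follow the convention [0 * +oo = 0];
   sums are never of the form [+oo - oo] for phi with values in R u {+oo}. *)
Definition econvex_function phi : Prop :=
  forall (x y : convex_lmodType X) (t : {i01 R}),
    (phi (conv t x y) <= t%:num%:E * phi x + (1 - t%:num)%:E * phi y)%E.

Definition lower_semicontinuous_at phi (x : X) : Prop :=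
  forall a : R, (a%:E < phi x)%E -> \forall y \near x, (a%:E < phi y)%E.

Definition esubdiff (eps : R) phi (x : X) : set (dual X) :=
  [set u | forall y : X, ((u (y - x) : R)%:E - eps%:E <= phi y - phi x)%E].

End extended_real_functions.

(* Main.v *)
Require Import Defs.
From HB Require Import structures.
From mathcomp Require Import all_boot all_order all_algebra.
From mathcomp Require Import all_classical all_reals all_analysis.
From mathcomp Require Import ring lra.
Import Order.TTheory GRing.Theory Num.Theory.
Import numFieldNormedType.Exports.
Local Open Scope classical_set_scope.
Local Open Scope ring_scope.

(** The equivalence is a cycle in which only two implications have content; the
others compare [esubdiff eps] with [esubdiff eps'] for [eps <= eps'].

From convexity, semicontinuity and the Lipschitz bound to the inclusion of
subdifferentials: if [u] is an [eps]-subgradient of [f] at [x], then the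
Lipschitz bound gives, for [y] in the domain,
[u (y - x) - K * `|y - x| - eps <= g y - g x].  So the sublinear function
[z |-> K * `|z| - u z] dominates the concave function
[d |-> g x - g (x + d) - eps], and a sandwich form of the Hahn-Banach theorem
([mazur_orlicz_sandwich]) puts minus a linear form [v] between them.  The upper
bound says that [v] is within [K] of [u], the lower one that [v] is an
[eps]-subgradient of [g] ([esubdiff_within]).  The cone term is continuous, hence
nothing is lost on [eps].  Nonemptiness is the same statement for [u = 0]: a
convex function that is lower semicontinuous at [x] lies above
[y |-> phi x - M * `|y - x| - eps] for a suitable [M] ([lsc_conic_minorant]).

From close subdifferentials back to convexity, semicontinuity and the Lipschitz
bound: a function with [eps]-subgradients for all [eps] is up to [eps] a supremum
of continuous affine functions, hence convex and lower semicontinuous.  The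
Lipschitz bound is an integration argument on a segment
([increment_le_of_close_slopes]).  On a subdivision into [n] steps, bound the
increment of [f] over a step by its approximate slope at the right end, and that
of [g] from below by its approximate slope at the left end.  The slopes of [f]
and [g] at one node nearly agree, so what remains telescopes to the difference of
the slopes of [f] at the two ends of the segment, divided by [n].

The Hahn-Banach theorem itself comes from Zorn's lemma applied to sublinear
functions rather than to partial linear forms: a minimal sublinear function is
linear ([hahn_banach_sublinear]). *)

(** * Sublinear functions and the Hahn-Banach theorem *)

Section hahn_banach.
Set Implicit Arguments.
Unset Strict Implicit.
Context {R : realType} {X : lmodType R}.
Implicit Types (p q k : X -> R) (z : X).

(** Homogeneity is only asked as an inequality, which is what an infimum satisfies
directly; applied to [t^-1] as well, it gives the equality. *)
Definition sublinear p : Prop :=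
  [/\ p 0 = 0, (forall y z, p (y + z) <= p y + p z)
    & (forall t z, 0 < t -> p (t *: z) <= t * p z)].

Lemma sublinearZ p t z : sublinear p -> 0 <= t -> p (t *: z) = t * p z.
Proof.
move=> [p0 _ pZ]; rewrite le_eqVlt => /predU1P[<-|t0].
  by rewrite scale0r mul0r.
apply/le_anti; rewrite pZ//= -ler_pdivlMl//.
by have := pZ _ (t *: z) (_ : 0 < t^-1); rewrite scalerK ?gt_eqF// invr_gt0; apply.
Qed.

Lemma sublinear_lbound p z : sublinear p -> - p (- z) <= p z.
Proof. by move=> [p0 pD _]; rewrite lerNl -subr_ge0 opprK -p0 -(addNr z). Qed.

(** The tilting construction behind both uses of sublinearity below.  The function
is the infimum of [p (z + d) + r] over [(d, r)] in the convex cone [S] of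
[X * R]; it is finite because [p d + r >= 0] on [S] bounds it below by
[- p (- z)].  With the ray through [(y, - p y)] it forces additivity of a minimal
function; with the cone generated by the epigraph of a convex function it encodes
the lower bound of the sandwich. *)
Lemma sublinear_cone_inf p (S : X -> R -> Prop) :
    sublinear p -> S 0 0 ->
    (forall d r d' r', S d r -> S d' r' -> S (d + d') (r + r')) ->
    (forall t d r, 0 < t -> S d r -> S (t *: d) (t * r)) ->
    (forall d r, S d r -> 0 <= p d + r) ->
  exists2 q, sublinear q & forall z d r, S d r -> q z <= p (z + d) + r.
Proof.
move=> sp S0 SD SZ Sp; have [p0 pD pZ] := sp.
pose V z := [set s | exists d r, S d r /\ s = p (z + d) + r].
pose q z := inf (V z).
have V0 z : V z !=set0 by exists (p (z + 0) + 0), 0, 0.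
have qle z d r : S d r -> q z <= p (z + d) + r.
  move=> Sdr; apply: ge_inf; last by exists d, r.
  exists (- p (- z)) => _ [e [s [Ses ->]]].
  have := Sp _ _ Ses; have := pD (z + e) (- z).
  by rewrite addrAC subrr add0r; lra.
have lbq z b : (forall d r, S d r -> b <= p (z + d) + r) -> b <= q z.
  by move=> bV; apply: lb_le_inf => // _ [d [r [Sdr ->]]]; exact: bV.
exists q => //; split.
- apply/le_anti/andP; split.
    by have := qle 0 0 0 S0; rewrite !addr0 p0.
  by apply: (lbq _) => d r Sdr; rewrite add0r; exact: Sp.
- move=> y z; rewrite -lerBlDr; apply: (lbq _) => d r Sdr.
  rewrite lerBlDr -lerBlDl; apply: (lbq z) => e s Ses; rewrite lerBlDl.
  have := qle (y + z) _ _ (SD _ _ _ _ Sdr Ses).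
  by have := pD (y + d) (z + e); rewrite addrACA; lra.
- move=> t z t0; rewrite -ler_pdivrMl//; apply: (lbq _) => d r Sdr.
  rewrite ler_pdivrMl//; have := qle (t *: z) _ _ (SZ _ _ _ t0 Sdr).
  by move/le_trans; apply; rewrite -scalerDr mulrDr lerD2r pZ.
Qed.

(** Zorn's lemma applies since the pointwise infimum of a chain of sublinear
functions below [p] is bounded below by [- p (- z)], and is subadditive because
any two members of the chain are comparable. *)
Lemma sublinear_minimal p : sublinear p ->
  exists q, [/\ sublinear q, (forall z, q z <= p z)
    & forall q', sublinear q' -> (forall z, q' z <= q z) -> q' = q].
Proof.
move=> sp.
pose T := {q : X -> R | sublinear q /\ forall z, q z <= p z}.
pose below (q q' : T) := `[< forall z, sval q' z <= sval q z >].
have Tsub (r : T) : sublinear (sval r) by case: r => ? [].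
have Tle (r : T) z : sval r z <= p z by case: r => ? [].
have pT : sublinear p /\ forall z, p z <= p z by split.
have [||A Atot|[q [sq qp]] qmin] := @ZL_preorder T (exist _ p pT) below.
- by move=> q; exact/asboolP.
- move=> q1 q2 q3 /asboolP q12 /asboolP q23; apply/asboolP => z.
  exact: le_trans (q23 z) (q12 z).
- have [[q0 Aq0]|A0] := pselect (A !=set0); last first.
    by exists (exist _ p pT) => q Aq; exfalso; apply: A0; exists q.
  pose V z := [set sval q z | q in A].
  pose m z := inf (V z).
  have V0 z : V z !=set0 by exists (sval q0 z), q0.
  have mle z (q : T) : A q -> m z <= sval q z.
    move=> Aq; apply: ge_inf; last by exists q.
    exists (- p (- z)) => _ [r _ <-].
    by apply: le_trans (sublinear_lbound z (Tsub r)); rewrite lerN2.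
  have lbm z b : (forall q : T, A q -> b <= sval q z) -> b <= m z.
    by move=> bV; apply: lb_le_inf => // _ [q Aq <-]; exact: bV.
  have sm : sublinear m.
    split.
    + apply/le_anti/andP; split.
        by apply: (le_trans (mle _ _ Aq0)); have [-> _ _] := Tsub q0.
      by apply: (lbm _) => q _; have [-> _ _] := Tsub q.
    + move=> y z; rewrite -lerBlDr; apply: (lbm _) => q1 Aq1.
      rewrite lerBlDr -lerBlDl; apply: (lbm _) => q2 Aq2; rewrite lerBlDl.
      have [/asboolP q12|/asboolP q21] := Atot _ _ Aq1 Aq2.
      * apply: le_trans (_ : sval q2 y + sval q2 z <= _); last by rewrite lerD2r.
        by apply: (le_trans (mle _ _ Aq2)); have [_ + _] := Tsub q2; apply.
      * apply: le_trans (_ : sval q1 y + sval q1 z <= _); last by rewrite lerD2l.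
        by apply: (le_trans (mle _ _ Aq1)); have [_ + _] := Tsub q1; apply.
    + move=> t z t0; rewrite -ler_pdivrMl//; apply: (lbm _) => q Aq.
      rewrite ler_pdivrMl//; apply: (le_trans (mle _ _ Aq)).
      by have [_ _ +] := Tsub q; apply.
  have mp z : m z <= p z.
    exact: le_trans (mle _ _ Aq0) (Tle _ _).
  exists (exist _ m (conj sm mp)) => q Aq; apply/asboolP => z; exact: mle.
- exists q; split=> // q' sq' q'q.
  have q'p z : q' z <= p z by exact: le_trans (q'q z) (qp z).
  have /asboolP/= := qmin (exist _ q' (conj sq' q'p)) (asboolT q'q).
  by move=> qq'; apply/funext => z; apply/le_anti; rewrite q'q qq'.
Qed.

(** Let [q] be minimal below [p].  Tilting [q] along the ray spanned by
[(z, - q z)] gives a smaller sublinear function, so [q] itself, and this reads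
[q y <= q (y + z) - q z]: hence [q] is additive. *)
Lemma hahn_banach_sublinear p : sublinear p ->
  exists2 w : X -> R^o, linear w & forall z, w z <= p z.
Proof.
move=> /sublinear_minimal[q [sq qp qmin]]; exists q => //.
have [q0 qD _] := sq.
have qDE y z : q (y + z) = q y + q z.
  apply/le_anti; rewrite qD//=.
  have [| | | |q' sq' q'q] := sublinear_cone_inf
      (S := fun d r => exists2 t, 0 <= t & d = t *: z /\ r = - (t * q z)) sq.
  - by exists 0 => //; rewrite scale0r mul0r oppr0.
  - move=> _ _ _ _ [s s0 [-> ->]] [t t0 [-> ->]]; exists (s + t).
      exact: addr_ge0.
    by rewrite scalerDl mulrDl opprD.
  - move=> s _ _ s0 [t t0 [-> ->]]; exists (s * t).
      by rewrite mulr_ge0// ltW.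
    by rewrite scalerA mulrN mulrA.
  - by move=> _ _ [t t0 [-> ->]]; rewrite sublinearZ// subrr.
  have q'E : q' = q.
    apply: qmin => // x; have := q'q x 0 0; rewrite !addr0; apply.
    by exists 0 => //; rewrite scale0r mul0r oppr0.
  rewrite -lerBrDr -q'E q'E -{1}q'E; apply: q'q.
  by exists 1 => //; rewrite scale1r mul1r.
have qN z : q (- z) = - q z.
  by apply/eqP; rewrite -addr_eq0 -qDE addNr q0.
move=> a y z; rewrite qDE; congr (_ + _).
have [a0|a0] := leP 0 a; first exact: sublinearZ.
by rewrite -[a in LHS]opprK scaleNr qN sublinearZ ?oppr_ge0 ?ltW// mulNr opprK.
Qed.

(** Tilt [p] by the cone generated by the epigraph of [k] over [C], take a linear
form [v] below the result, and let [w z = v (- z)]: the vertex of the cone gives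
[v <= p], and the point [(d, k d)] gives [v (- d) <= k d]. *)
Lemma mazur_orlicz_sandwich p (C : set X) k :
    sublinear p -> C !=set0 ->
    (forall c d s, C c -> C d -> 0 <= s <= 1 ->
       C (s *: c + (1 - s) *: d) /\
       k (s *: c + (1 - s) *: d) <= s * k c + (1 - s) * k d) ->
    (forall d, C d -> 0 <= p d + k d) ->
  exists2 w : X -> R^o, linear w &
    (forall z, - p z <= w z) /\ (forall d, C d -> w d <= k d).
Proof.
move=> sp [c0 Cc0] Ck pk.
have [p0 _ _] := sp.
have [| | | |q sq qp] := sublinear_cone_inf
   (S := fun e r => exists t d, [/\ 0 <= t, C d, e = t *: d & t * k d <= r]) sp.
- by exists 0, c0; rewrite scale0r mul0r.
- move=> _ r _ r' [s [c [s0 Cc -> cr]]] [t [d [t0 Cd -> dr]]].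
  exists (s + t).
  (* The vertex of the cone is a multiple of any point of C. *)
  have [st0|st0] := eqVneq (s + t) 0.
    have [s00 t00] : s = 0 /\ t = 0 by split; lra.
    exists c; rewrite st0; move: cr dr; rewrite s00 t00 !scale0r !mul0r.
    by split => //; rewrite ?addr0//; lra.
  have s'01 : 0 <= s / (s + t) <= 1.
    rewrite divr_ge0 ?addr_ge0//= ler_pdivrMr ?mul1r ?lerDl//.
    by rewrite lt_neqAle eq_sym st0 addr_ge0.
  have := Ck _ _ _ Cc Cd s'01; set e := _ + _ => -[Ce ke].
  have t'E : 1 - s / (s + t) = t / (s + t) by field.
  exists e; split => //; first exact: addr_ge0.
    by rewrite scalerDr !scalerA t'E ![_ / _]mulrC !mulVKf.
  have := ler_wpM2l (addr_ge0 s0 t0) ke; rewrite t'E.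
  suff -> : (s + t) * (s / (s + t) * k c + t / (s + t) * k d) =
            s * k c + t * k d by lra.
  by field.
- move=> t _ r t0 [s [d [s0 Cd -> sr]]]; exists (t * s), d; split => //.
  + by rewrite mulr_ge0// ltW.
  + by rewrite scalerA.
  + by rewrite -mulrA ler_pM2l.
- move=> _ r [t [d [t0 Cd -> tr]]]; rewrite sublinearZ//.
  by have := mulr_ge0 t0 (pk _ Cd); rewrite mulrDr; lra.
have [v lv vq] := hahn_banach_sublinear sq.
pose lin := GRing.isLinear.Build R X R^o *:%R v lv.
pose V : {linear X -> R^o} := HB.pack v lin.
exists (fun z => v (- z)).
  move=> a y z; rewrite /= -[v]/(V : X -> R^o).
  by rewrite !linearN linearD linearZ/= opprD.
split=> [z|d Cd].
  rewrite -[v]/(V : X -> R^o) linearN lerN2; apply: (le_trans (vq z)).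
  have := qp z 0 0; rewrite !addr0; apply.
  by exists 0, c0; rewrite scale0r mul0r.
apply: (le_trans (vq _)); have := qp (- d) d (k d).
rewrite addNr p0 add0r; apply; exists 1, d.
by rewrite scale1r mul1r.
Qed.

End hahn_banach.

(** * Dual norm *)

Section dual_space.
Set Implicit Arguments.
Unset Strict Implicit.
Context {R : realType} {X : normedModType R}.
Implicit Types (u v : dual X) (M : R).

Lemma dual_norm_ge u x : `|u x| <= dual_norm u * `|x|.
Proof.
have [->|x0] := eqVneq x 0; first by rewrite raddf0 !normr0 mulr0.
have nx0 : 0 < `|x| by rewrite normr_gt0.
rewrite -ler_pdivrMr// mulrC.
have -> : `|x|^-1 * `|u x| = `|u (`|x|^-1 *: x)|.
  by rewrite linearZ/= normrM gtr0_norm// invr_gt0.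
apply: ub_le_sup; first by have [] := has_sup_dual_norm u.
exists (`|x|^-1 *: x) => //=.
by rewrite normrZ gtr0_norm ?invr_gt0// mulVf// gt_eqF.
Qed.

Lemma dual_norm_le u M : (forall x, `|u x| <= M * `|x|) -> 0 <= M ->
  dual_norm u <= M.
Proof.
move=> uM M0; apply: ge_sup; first by have [] := has_sup_dual_norm u.
by move=> _ [x /= x1 <-]; apply: (le_trans (uM x)); rewrite ler_piMr.
Qed.

Lemma dual_normB u v : dual_norm (u - v) = dual_norm (v - u).
Proof.
rewrite /dual_norm; congr sup; apply/seteqP.
by split=> _ [x x1 <-]; exists x => //; rewrite distrC.
Qed.

Lemma dual_ballE M u : dual_ball M u <-> dual_norm u <= M.
Proof. by rewrite /dual_ball /closed_ball_/= dual_normB subr0. Qed.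

(** A one-sided bound is enough for continuity, by oddness of [w]. *)
Lemma dual_of_le_norm (w : X -> R^o) M : linear w ->
  (forall x, - (M * `|x|) <= w x) -> exists u : dual X, forall x, u x = w x.
Proof.
move=> lw wM.
pose lin := GRing.isLinear.Build R X R^o *:%R w lw.
pose W : {linear X -> R^o} := HB.pack w lin.
have wM' x : `|w x| <= M * `|x|.
  rewrite ler_norml wM/= -[w]/(W : X -> R^o) -lerN2 -linearN/=.
  by rewrite -(normrN x) wM.
have cw : continuous w.
  apply: (@bounded_linear_continuous _ _ _ W); apply/linear_boundedP.
  near=> r => x; apply: (le_trans (wM' x)).
  by rewrite ler_wpM2r//; near: r; exact: nbhs_pinfty_ge.
have wdual : w \in @continuous_linear R X by rewrite inE.
by exists (Dual wdual).
Unshelve. all: by end_near. Qed.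

End dual_space.

(** * Approximate subgradients of an extended-real-valued function *)

Section epsilon_subdifferential.
Set Implicit Arguments.
Unset Strict Implicit.
Context {R : realType} {X : normedModType R} (phi : X -> \bar R).
Hypothesis phi_gtNy : forall x, phi x != -oo%E.
Implicit Types (u v : dual X) (eps M : R) (x y : X).
Local Notation D := (effective_domain phi).

Lemma effective_domain_lty x : D x <-> (phi x < +oo)%E.
Proof.
by rewrite /effective_domain/= fin_numE phi_gtNy ltey; split.
Qed.

Lemma notin_effective_domain x : ~ D x -> phi x = +oo%E.
Proof. by move=> /effective_domain_lty/negP; rewrite -leNgt leye_eq => /eqP. Qed.

Lemma esubdiffP eps x u : D x ->
  esubdiff eps phi x u <->
  forall y, D y -> u (y - x) - eps <= fine (phi y) - fine (phi x).
Proof.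
move=> Dx; split=> ux y.
  by move=> Dy; have := ux y; rewrite -(fineK Dx) -(fineK Dy) -!EFinB lee_fin.
have [Dy|/notin_effective_domain ->] := pselect (D y).
  by rewrite -(fineK Dx) -(fineK Dy) -!EFinB lee_fin; exact: ux.
by rewrite -(fineK Dx) -!EFinB addye// leey.
Qed.

Lemma esubdiff_mono eps eps' x : eps <= eps' ->
  esubdiff eps phi x `<=` esubdiff eps' phi x.
Proof.
by move=> ee' u ux y; apply: le_trans (ux y); rewrite -!EFinB lee_fin lerB.
Qed.

(** The form in which convexity is used: it also returns that the domain is
convex, since [phi] is bounded above by a real number on the segment. *)
Lemma econvex_fine x y (s : R) : econvex_function phi -> D x -> D y ->
  0 <= s <= 1 ->
  D (s *: x + (1 - s) *: y) /\
  fine (phi (s *: x + (1 - s) *: y)) <= s * fine (phi x) + (1 - s) * fine (phi y).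
Proof.
move=> cphi Dx Dy /andP[s0 s1].
have := cphi x y (Itv01 s0 s1).
have -> : conv (Itv01 s0 s1) (x : convex_lmodType X) y = s *: x + (1 - s) *: y by [].
rewrite /= -{1}(fineK Dx) -{1}(fineK Dy) -!EFinM -EFinD => xy.
have Dxy : D (s *: x + (1 - s) *: y).
  by apply/effective_domain_lty; rewrite (le_lt_trans xy)// ltry.
by split=> //; move: xy; rewrite -(fineK Dxy) lee_fin.
Qed.

(** An [eps]-subgradient at a convex combination [z] of [x] and [y] minorizes
[phi] by an affine function equal to [phi z - eps] at [z]; averaging its values
at [x] and [y] gives the convexity inequality up to [eps]. *)
Lemma esubdiff_econvex : convex_set (D : set (convex_lmodType X)) ->
  (forall x, D x -> forall eps, 0 < eps -> esubdiff eps phi x !=set0) ->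
  econvex_function phi.
Proof.
move=> cD subD x y t.
(* At the ends of the segment the convention 0 * +oo = 0 is what is tested. *)
have [->|t0] := eqVneq t 0%:i01.
  by rewrite conv0/= mul0e add0e subr0 mul1e.
have [->|t1] := eqVneq t 1%:i01.
  by rewrite conv1/= mul1e subrr mul0e adde0.
have {}t0 : 0 < t%:num by rewrite lt_neqAle eq_sym t0 ge0.
have {}t1 : 0 < 1 - t%:num by rewrite subr_gt0 lt_neqAle t1 le1.
have NyM (r : R) z : 0 < r -> (r%:E * phi z)%E != -oo%E.
  move=> r0; case: (phi z) (phi_gtNy z) => // _; by rewrite gt0_muley ?lte_fin.
have [Dx|/notin_effective_domain ->] := pselect (D x); last first.
  by rewrite gt0_muley ?lte_fin// addye ?NyM// leey.
have [Dy|/notin_effective_domain ->] := pselect (D y); last first.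
  by rewrite [X in (_ + X)%E]gt0_muley ?lte_fin// addey ?NyM// leey.
set z := conv t x y.
have zE : z = t%:num *: x + (1 - t%:num) *: y by [].
have Dz : D z by apply/set_mem/cD; exact/mem_set.
rewrite -(fineK Dx) -(fineK Dy) -(fineK Dz) -!EFinM -EFinD lee_fin.
apply/ler_addgt0Pr => eps eps0.
have [u /(esubdiffP _ _ Dz) uz] := subD z Dz eps eps0.
have := ler_wpM2l (ltW t0) (uz x Dx); have := ler_wpM2l (ltW t1) (uz y Dy).
have : t%:num * u (x - z) + (1 - t%:num) * u (y - z) = 0.
  rewrite -[t%:num * _]/(t%:num *: u (x - z)) -[_ * u (y - z)]/(_ *: u (y - z)).
  rewrite -!linearZ -linearD/= !scalerBr addrACA -zE -opprD -scalerDl.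
  by rewrite [t%:num + _]addrC subrK scale1r subrr raddf0.
rewrite !mulrBr; lra.
Qed.

Lemma esubdiff_lsc x : D x ->
  (forall eps, 0 < eps -> esubdiff eps phi x !=set0) ->
  lower_semicontinuous_at phi x.
Proof.
move=> Dx subx a; rewrite -(fineK Dx) lte_fin => ax.
have e0 : 0 < (fine (phi x) - a) / 2 by rewrite divr_gt0 ?subr_gt0.
have [u /(esubdiffP _ _ Dx) ux] := subx _ e0.
have /cvgrPdist_lt/(_ _ e0) := @dual_continuous _ _ u x.
apply: filterS => y; rewrite -linearB -opprB linearN normrN => uxy.
have [Dy|/notin_effective_domain ->] := pselect (D y); last by rewrite ltry.
rewrite -(fineK Dy) lte_fin; have := ux y Dy.
by move: uxy; rewrite ltr_norml => /andP[]; lra.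
Qed.

(** An [eps]-subgradient of [phi + M * `|. - x|] at [x] is within [M] of an
[eps]-subgradient of [phi], with the same [eps].  This is the sum rule in the
case where one term is a cone with vertex [x], whose approximate subdifferentials
at [x] are all the ball of radius [M]. *)
Lemma esubdiff_within eps x u M : econvex_function phi -> D x -> 0 <= M ->
  (forall y, D y ->
     u (y - x) - M * `|y - x| - eps <= fine (phi y) - fine (phi x)) ->
  exists2 v, esubdiff eps phi x v & dual_norm (u - v) <= M.
Proof.
move=> cphi Dx M0 uphi.
have uN z : u (- z) = - u z by exact: raddfN.
have [| | | |w lw [pw wk]] := @mazur_orlicz_sandwich R X
    (fun z => M * `|z| - u z) [set d | D (x + d)]
    (fun d => fine (phi (x + d)) - fine (phi x) + eps).
- split=> [|y z|t z t0].
  + by rewrite raddf0 normr0 mulr0 subr0.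
  + rewrite raddfD/=; have := ler_wpM2l M0 (ler_normD y z).
    by rewrite mulrDr; lra.
  + by rewrite linearZ/= normrZ gtr0_norm// mulrBr mulrCA.
- by exists 0; rewrite /= addr0.
- move=> c d s /= Dc Dd s01.
  have -> : x + (s *: c + (1 - s) *: d) = s *: (x + c) + (1 - s) *: (x + d).
    by rewrite !scalerDr addrACA -scalerDl [s + _]addrC subrK scale1r.
  by have [? ?] := econvex_fine cphi Dc Dd s01; split => //; lra.
- by move=> d /uphi; rewrite [x + d]addrC addrK; lra.
have [v vw] : exists v : dual X, forall z, v z = w z.
  apply: (@dual_of_le_norm _ _ w (M + dual_norm u)) => // z.
  apply: le_trans (pw z); rewrite lerN2 mulrDl lerD2l.
  by rewrite -uN (le_trans (ler_norm _))// -(normrN z) dual_norm_ge.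
exists v.
  apply/esubdiffP => // y Dy; have := wk (y - x).
  by rewrite /= [x + _]addrC subrK vw => /(_ Dy); lra.
apply: dual_norm_le => // z.
have uvE y : (u - v) y = u y - v y by [].
rewrite uvE ler_norml; have := pw z; have := pw (- z).
by rewrite -!vw !raddfN/= normrN; lra.
Qed.

(** Near [x], lower semicontinuity alone gives [phi y >= phi x - eps].  Far from
[x], convexity compares [phi y] with the value of [phi] at the point of the
segment from [x] to [y] at distance [r / 2] from [x], where the first bound holds. *)
Lemma lsc_conic_minorant x eps : econvex_function phi -> D x -> 0 < eps ->
  lower_semicontinuous_at phi x ->
  exists2 M, 0 <= M & forall y, D y ->
    - (M * `|y - x|) - eps <= fine (phi y) - fine (phi x).
Proof.
move=> cphi Dx eps0 lx.
have /lx : ((fine (phi x) - eps)%:E < phi x)%E.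
  by rewrite -{2}(fineK Dx) lte_fin ltrBlDr ltrDl.
move=> /nbhs_normP[r /= r0 rphi].
exists (2 * eps / r); first by rewrite divr_ge0 ?mulr_ge0 ?ltW.
move=> y Dy.
have near_x z : D z -> `|z - x| < r -> fine (phi x) - eps < fine (phi z).
  by move=> Dz zx; rewrite -lte_fin (fineK Dz); apply: rphi; rewrite /= distrC.
have [yx|yx] := ltP `|y - x| r.
  have := near_x _ Dy yx.
  suff : 0 <= 2 * eps / r * `|y - x| by lra.
  by rewrite mulr_ge0// divr_ge0 ?mulr_ge0 ?ltW.
have n0 : 0 < `|y - x| by exact: lt_le_trans yx.
(* s *: y + (1 - s) *: x is at distance r / 2 from x. *)
pose s := r / (2 * `|y - x|).
have s0 : 0 < s by rewrite divr_gt0// mulr_gt0.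
have s1 : s <= 1 by rewrite ler_pdivrMr ?mulr_gt0// mul1r; lra.
have [|Dz phiz] := @econvex_fine y x s cphi Dy Dx.
  by rewrite (ltW s0) s1.
have := near_x _ Dz.
have -> : s *: y + (1 - s) *: x - x = s *: (y - x).
  by rewrite scalerBl scale1r scalerBr addrA addrAC addrK.
rewrite normrZ gtr0_norm// {1}/s => /(_ _)/wrap[].
  by rewrite invfM mulrA mulfVK ?gt_eqF// ltr_pdivrMr//; lra.
move=> near_z.
have sphi : - eps <= s * (fine (phi y) - fine (phi x)) by rewrite mulrBr; lra.
have -> : 2 * eps / r * `|y - x| = eps / s.
  by rewrite /s; field; rewrite !gt_eqF.
rewrite lerBlDr; apply: (@le_trans _ _ (fine (phi y) - fine (phi x))).
  by rewrite -mulNr ler_pdivrMr// mulrC.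
by rewrite lerDl ltW.
Qed.

Lemma esubdiff_neq0 x eps : econvex_function phi -> D x -> 0 < eps ->
  lower_semicontinuous_at phi x -> esubdiff eps phi x !=set0.
Proof.
move=> cphi Dx eps0 /lsc_conic_minorant-/(_ _ cphi Dx eps0)[M M0 phiM].
have [y Dy|v vx _] := @esubdiff_within eps x 0 M cphi Dx M0; last by exists v.
by rewrite -[(0 : dual X) _]/(0 : R) add0r; exact: phiM.
Qed.

End epsilon_subdifferential.

(** * Integration of approximate slopes *)

Section integration.
Set Implicit Arguments.
Unset Strict Implicit.

(** The slopes of [phi] may blow up at the ends of the segment as the tolerance
tends to 0 (take [phi t = - sqrt t]).  Therefore the tolerance at 0 and 1 is a fixed [eta], so that the two end
slopes do not depend on the number [n] of steps, and it is [eta / n] at the inner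
nodes, so that the errors add up to a multiple of [eta]. *)
Lemma increment_le_of_close_slopes (R : realType) (phi psi : R -> R) (C : R) :
  (forall t eps : R, 0 <= t <= 1 -> 0 < eps -> exists a b, [/\ a - b <= C + eps,
     forall s, 0 <= s <= 1 -> a * (s - t) - eps <= phi s - phi t
   & forall s, 0 <= s <= 1 -> b * (s - t) - eps <= psi s - psi t]) ->
  (phi 1 - psi 1) - (phi 0 - psi 0) <= C.
Proof.
move=> slopes.
(* The slopes are chosen as a function of the node and of the tolerance alone,
   before n is fixed; n is then taken large relative to the end slopes. *)
have /choice[ab abP] : forall te : R * R, exists ab : R * R,
    0 <= te.1 <= 1 -> 0 < te.2 -> [/\ ab.1 - ab.2 <= C + te.2,
     forall s, 0 <= s <= 1 -> ab.1 * (s - te.1) - te.2 <= phi s - phi te.1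
   & forall s, 0 <= s <= 1 -> ab.2 * (s - te.1) - te.2 <= psi s - psi te.1].
  move=> [t eps]; have [/andP[t01 eps0]|bad] := boolP ((0 <= t <= 1) && (0 < eps)).
    by have [a [b abP]] := slopes _ _ t01 eps0; exists (a, b).
  by exists (0, 0) => /= t01 eps0; move: bad; rewrite t01 eps0.
suff main eta : 0 < eta -> (phi 1 - psi 1) - (phi 0 - psi 0) <= C + 6 * eta.
  apply/ler_addgt0Pr => e e0; have := main (e / 6).
  by rewrite mulrCA divff// mulr1 divr_gt0//; apply.
move=> eta0.
pose w := (ab (1, eta)).1 - (ab (0, eta)).1.
pose n := (Num.bound (`|w| / eta)).+1.
have n0 : 0 < n%:R :> R by rewrite ltr0n.
have wn : w / n%:R <= eta.
  rewrite ler_pdivrMr// mulrC -ler_pdivrMr//.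
  apply: (@le_trans _ _ (`|w| / eta)).
    by rewrite ler_pM2r ?invr_gt0// ler_norm.
  apply/ltW/(lt_le_trans (archi_boundP _)); first by rewrite divr_ge0// ltW.
  by rewrite ler_nat.
pose E i : R := if (0 < i < n)%N then eta / n%:R else eta.
pose tm i : R := i%:R / n%:R.
pose A i := (ab (tm i, E i)).1; pose B i := (ab (tm i, E i)).2.
have E0 i : 0 < E i by rewrite /E; case: ifP => // _; rewrite divr_gt0.
have tm01 i : (i <= n)%N -> 0 <= tm i <= 1.
  by move=> iln; rewrite divr_ge0//= ler_pdivrMr// mul1r ler_nat.
have Ele i : E i <= eta.
  rewrite /E; case: ifP => // _; rewrite ler_pdivrMr// ler_peMr//; first exact: ltW.
  by rewrite ler1n.
have tmS i : tm i.+1 - tm i = n%:R^-1.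
  by rewrite -mulrBl -natr1 addrAC subrr add0r mul1r.
have step i : (0 <= i < n)%N ->
    (phi (tm i.+1) - psi (tm i.+1)) - (phi (tm i) - psi (tm i)) <=
    (A i.+1 - A i) / n%:R + (C + eta) / n%:R + (E i + E i.+1).
  move=> /= iltn; have ilen := ltnW iltn.
  have [ABi _ /(_ _ (tm01 _ iltn)) psii] := abP (tm i, E i) (tm01 _ ilen) (E0 i).
  have [_ /(_ _ (tm01 _ ilen)) phii _] := abP (tm i.+1, E i.+1) (tm01 _ iltn) (E0 _).
  have {}ABi : (A i - B i) / n%:R <= (C + eta) / n%:R.
    by rewrite ler_pM2r ?invr_gt0// (le_trans ABi)// lerD2l Ele.
  move: psii phii; rewrite /= -/(A _) -/(B _) tmS -(opprB (tm i.+1)) tmS; lra.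
have := ler_sum_nat step.
rewrite (telescope_sumr (fun i => phi (tm i) - psi (tm i)))// !big_split/=.
rewrite -mulr_suml telescope_sumr// !sumr_const_nat subn0.
have -> : ((C + eta) / n%:R) *+ n = C + eta by rewrite -[LHS]mulr_natr divfK ?gt_eqF.
have tm0 : tm 0 = 0 by rewrite /tm mul0r.
have tmn : tm n = 1 by rewrite /tm divff ?gt_eqF.
have -> : A n - A 0%N = w by rewrite /A tm0 tmn /E ltnn andbF.
rewrite tm0 tmn => /le_trans; apply.
have sumE : \sum_(1 <= i < n) E i <= eta.
  have -> : \sum_(1 <= i < n) E i = (eta / n%:R) *+ n.-1.
    rewrite (eq_big_nat _ _ (F2 := fun=> eta / n%:R)); last first.
      by move=> i; rewrite /E => ->.
    by rewrite sumr_const_nat subn1.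
  rewrite -[leLHS]mulr_natr -mulrA ler_piMr//; first exact: ltW.
  by rewrite ler_pdivrMl// mulr1 ler_nat.
have -> : \sum_(0 <= i < n) E i = eta + \sum_(1 <= i < n) E i.
  by rewrite big_ltn.
have -> : \sum_(0 <= i < n) E i.+1 = \sum_(1 <= i < n) E i + eta.
  by rewrite -(big_add1 _ _ _ n.+1 xpredT)/= big_nat_recr//= {2}/E ltnn andbF.
by move: wn sumE; lra.
Qed.

End integration.

(** * Functions with close approximate subdifferentials *)

Section subdifferential_distance.
Set Implicit Arguments.
Unset Strict Implicit.
Context {R : realType} {X : normedModType R}.
Implicit Types (A B : set (dual X)) (f g : X -> \bar R) (K eps : R).

Lemma minkowski_sum_ballP B K (u : dual X) :
  minkowski_sum B (dual_ball K) u <->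
  exists2 v, B v & dual_norm (u - v) <= K.
Proof.
split=> [[v Bv [b /dual_ballE bK <-]]|[v Bv uvK]].
  by exists v => //; rewrite addrC addKr.
by exists v => //; exists (u - v); [exact/dual_ballE | rewrite addrC subrK].
Qed.

Lemma dual_dist_le A B K u v : A u -> B v -> dual_norm (u - v) <= K ->
  (dual_dist A B <= K%:E)%E.
Proof.
move=> Au Bv uvK; apply: le_trans (_ : (dual_norm (u - v))%:E <= _)%E => //.
by apply: ereal_inf_lbound; exists u => //; exists v.
Qed.

Lemma dual_dist_approx A B K eps : (dual_dist A B <= K%:E)%E -> 0 < eps ->
  exists u v, [/\ A u, B v & dual_norm (u - v) <= K + eps].
Proof.
move=> dAB eps0.
have /ereal_inf_lt[_ [u Au [v Bv <-]] uvK] : (dual_dist A B < (K + eps)%:E)%E.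
  by rewrite (le_lt_trans dAB)// lte_fin ltrDl.
by exists u, v; split => //; rewrite -lee_fin ltW.
Qed.

Lemma dual_dist_anti A A' B B' : A `<=` A' -> B `<=` B' ->
  (dual_dist A' B' <= dual_dist A B)%E.
Proof.
move=> AA' BB'; apply: ereal_inf_le_tmp => _ [u Au [v Bv <-]].
by exists u; [exact: AA' | exists v => //; exact: BB'].
Qed.

(** Restriction to the segment from [x] to [y]: if [u] is an [eps]-subgradient at
a point of the segment, [u (y - x)] is an approximate slope of the restriction. *)
Lemma fine_sub_increment_le f g K x y :
    (forall x, f x != -oo%E) -> (forall x, g x != -oo%E) ->
    effective_domain f = effective_domain g ->
    convex_set (effective_domain f : set (convex_lmodType X)) ->
    (forall x, effective_domain f x -> forall eps, 0 < eps ->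
       (dual_dist (esubdiff eps f x) (esubdiff eps g x) <= K%:E)%E) ->
    effective_domain f x -> effective_domain f y ->
  (fine (f y) - fine (g y)) - (fine (f x) - fine (g x)) <= K * `|y - x|.
Proof.
move=> f_gtNy g_gtNy fg cf dfg Dx Dy.
pose z t := t *: y + (1 - t) *: x.
have Dz t : 0 <= t <= 1 -> effective_domain f (z t).
  move=> /andP[t0 t1]; apply/set_mem.
  by apply: (cf y x (Itv01 t0 t1)); exact/mem_set.
have zB s t : z s - z t = (s - t) *: (y - x).
  have zE r : z r = x + r *: (y - x).
    by rewrite /z scalerBl scale1r scalerBr addrCA.
  by rewrite !zE opprD addrACA subrr add0r -scalerBl.
have z0 : z 0 = x by rewrite /z scale0r add0r subr0 scale1r.
have z1 : z 1 = y by rewrite /z scale1r subrr scale0r addr0.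
rewrite -[in leLHS]z0 -[in leLHS]z1.
apply: (@increment_le_of_close_slopes R (fine \o f \o z) (fine \o g \o z)).
move=> t eps t01 eps0.
(* e absorbs the length of the segment: e * `|y - x| <= eps. *)
pose e := eps / (1 + `|y - x|).
have n1 : 0 < 1 + `|y - x| by rewrite ltr_pwDl.
have e0 : 0 < e by rewrite divr_gt0.
have [u [v [uf vg uv]]] := dual_dist_approx (dfg _ (Dz _ t01) _ eps0) e0.
exists (u (y - x)), (v (y - x)); split.
- have := dual_norm_ge (u - v) (y - x); have := ler_norm ((u - v) (y - x)).
  have uvE w : (u - v) w = u w - v w by [].
  rewrite uvE; have := ler_wpM2r (normr_ge0 (y - x)) uv.
  have : e * `|y - x| <= eps.
    by rewrite mulrAC ler_pdivrMr// ler_pM2l// lerDr.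
  by rewrite mulrDl; lra.
- move=> s s01; move/esubdiffP : uf => /(_ f_gtNy (Dz _ t01) _ (Dz _ s01)).
  by rewrite zB linearZ/= mulrC.
- move=> s s01; have := Dz _ s01; have := Dz _ t01; rewrite fg => Dt Ds.
  move/esubdiffP : vg => /(_ g_gtNy Dt _ Ds).
  by rewrite zB linearZ/= mulrC.
Qed.

End subdifferential_distance.

Theorem theorem5 (R : realType) (X : normedModType R) (f g : X -> \bar R)
    (D : set X) (K : R)
    (f_gtNy : forall x, f x != -oo%E) (g_gtNy : forall x, g x != -oo%E)
    (domf : effective_domain f = D) (domg : effective_domain g = D)
    (D_neq0 : D !=set0) (D_convex : convex_set (D : set (convex_lmodType X)))
    (K_ge0 : 0 <= K) :
  [<-> (* (i) *)
       [/\ econvex_function f,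
           econvex_function g,
           (forall x, D x -> lower_semicontinuous_at f x),
           (forall x, D x -> lower_semicontinuous_at g x)
         & K.-lipschitz_D (fun x => fine (f x) - fine (g x) : R^o)];
       (* (ii) *)
       (forall x, D x -> forall eps : R, 0 < eps ->
          esubdiff eps f x !=set0 /\
          esubdiff eps f x `<=`
            minkowski_sum (esubdiff eps g x) (dual_ball K));
       (* (iii) *)
       (forall x, D x -> exists2 delta : R, 0 < delta &
          forall eps : R, 0 < eps < delta ->
          esubdiff eps f x !=set0 /\
          esubdiff eps f x `<=`
            minkowski_sum (esubdiff eps g x) (dual_ball K));
       (* (iv) *)
       (forall x, D x -> forall eps : R, 0 < eps ->
          esubdiff eps f x `&`
            minkowski_sum (esubdiff eps g x) (dual_ball K) !=set0);
       (* (v) *)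
       (forall x, D x -> exists2 delta : R, 0 < delta &
          forall eps : R, 0 < eps < delta ->
          esubdiff eps f x `&`
            minkowski_sum (esubdiff eps g x) (dual_ball K) !=set0);
       (* (vi) *)
       (forall x, D x -> forall eps : R, 0 < eps ->
          (dual_dist (esubdiff eps f x) (esubdiff eps g x) <= K%:E)%E);
       (* (vii) *)
       (forall x, D x -> exists2 delta : R, 0 < delta &
          forall eps : R, 0 < eps < delta ->
          (dual_dist (esubdiff eps f x) (esubdiff eps g x) <= K%:E)%E)].
Proof.
have small (delta eps : R) : 0 < delta -> 0 < eps ->
    exists2 e : R, 0 < e < delta & e <= eps.
  move=> d0 e0; exists (Num.min (delta / 2) eps); last by rewrite ge_min lexx orbT.
  by rewrite lt_min e0 divr_gt0//= gt_min ltr_pdivrMr// ltr_pMr// ltr1n.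
tfae.
- move=> [cf cg lf lg fgK] x Dx eps eps0; split.
    by apply: esubdiff_neq0 => //; [rewrite domf | exact: lf].
  move=> u /esubdiffP uf; apply/minkowski_sum_ballP.
  apply: esubdiff_within => // [|y]; rewrite domg// => Dy.
  move: uf; rewrite domf => /(_ f_gtNy Dx y Dy).
  have := fgK (y, x) (conj Dy Dx); rewrite /= ler_norml => /andP[_]; lra.
- by move=> subfg x Dx; exists 1 => // eps /andP[eps0 _]; exact: subfg.
- move=> subfg x Dx eps eps0; have [delta d0 fgx] := subfg x Dx.
  have [e ed e_eps] := small _ _ d0 eps0.
  have [[u uf] /(_ u uf)/minkowski_sum_ballP[v vg uv]] := fgx e ed.
  exists u; split; first exact: esubdiff_mono uf.
  by apply/minkowski_sum_ballP; exists v => //; exact: esubdiff_mono vg.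
- by move=> subfg x Dx; exists 1 => // eps /andP[eps0 _]; exact: subfg.
- move=> subfg x Dx eps eps0; have [delta d0 fgx] := subfg x Dx.
  have [e ed e_eps] := small _ _ d0 eps0.
  have [u [uf /minkowski_sum_ballP[v vg uv]]] := fgx e ed.
  by apply: dual_dist_le uv; [exact: esubdiff_mono uf|exact: esubdiff_mono vg].
- by move=> dfg x Dx; exists 1 => // eps /andP[eps0 _]; exact: dfg.
- move=> dfg_small.
  have dfg x : D x -> forall eps : R, 0 < eps ->
      (dual_dist (esubdiff eps f x) (esubdiff eps g x) <= K%:E)%E.
    move=> Dx eps eps0; have [delta d0 fgx] := dfg_small x Dx.
    have [e ed e_eps] := small _ _ d0 eps0.
    by apply: le_trans (fgx e ed); apply: dual_dist_anti; exact: esubdiff_mono.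
  have subfg x (eps : R) : D x -> 0 < eps ->
      esubdiff eps f x !=set0 /\ esubdiff eps g x !=set0.
    move=> Dx eps0.
    have [u [v [uf vg _]]] := dual_dist_approx (dfg x Dx _ eps0) ltr01.
    by split; [exists u|exists v].
  have subf x : D x -> forall eps, 0 < eps -> esubdiff eps f x !=set0.
    by move=> Dx eps /(subfg x _ Dx)[].
  have subg x : D x -> forall eps, 0 < eps -> esubdiff eps g x !=set0.
    by move=> Dx eps /(subfg x _ Dx)[].
  split.
  + by apply: esubdiff_econvex => //; rewrite domf.
  + by apply: esubdiff_econvex => //; rewrite domg.
  + by move=> x Dx; apply: esubdiff_lsc => //; [rewrite domf | exact: subf].
  + by move=> x Dx; apply: esubdiff_lsc => //; [rewrite domg | exact: subg].
  + have incr x y : D x -> D y ->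
        (fine (f y) - fine (g y)) - (fine (f x) - fine (g x)) <= K * `|y - x|.
      move=> Dx Dy; apply: fine_sub_increment_le; rewrite ?domf ?domg//.
    move=> [y x] [/= Dy Dx]; rewrite ler_norml incr// andbT.
    by have := incr y x Dy Dx; rewrite distrC; lra.
Qed.
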